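(* Let $q$ be a prime power, $n$ a positive integer with $\gcd(n,q)=1$, and let $\mathbb{F}_q\subseteq\mathbb{K}\subseteq\mathbb{L}$ be fields with $U_n\subseteq\mathbb{L}$. Let $g\in\mathbb{K}[x]$ be a divisor of $x^n-1$ and let $\beta\in U_n$. If $\varphi^{-1}_{\beta,\overline{x^kg}}$ belongs to $\mathbb{F}_q(n)$ for some $k\in\{0,\dots,n-1\}$, then the family of permutation equivalent cyclic codes $$\left\{C_\alpha=\left(\varphi^{-1}_{\alpha,\overline{x^kg}}\right) : \alpha\in U_n\right\}$$ in $\mathbb{F}_q(n)$ satisfies $\Delta(C_\alpha)=d(C_\alpha)$ for all $\alpha\in U_n$. Moreover, in this case, $\dim_{\mathbb{F}_q}(C_\alpha)=|\mathrm{supp}(g)|$ for all $\alpha\in U_n$.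
   Context: $U_n$ is the set of primitive $n$-th roots of unity. For a field $F$, $F(n)=F[x]/(x^n-1)$; its elements are identified with polynomials of degree $<n$, and $\overline{f}$ is the image of $f\in F[x]$ in $F(n)$, i.e. its remainder modulo $x^n-1$. $\mathrm{supp}(f)$ is the set of exponents occurring in $f$ with nonzero coefficient. A cyclic code is an ideal $C$ of $\mathbb{F}_q(n)$; $(c)$ denotes the ideal of $\mathbb{F}_q(n)$ generated by $c$; $d(C)$ is the minimum distance of $C$, i.e. the minimum of $|\mathrm{supp}(c)|$ over nonzero $c\in C$. Two codes are permutation equivalent if one is obtained from the other by a fixed permutation of the $n$ coordinates (coefficients). For $\alpha\in U_n$, $D_\alpha(C)=\{i\in\mathbb{Z}_n : c(\alpha^i)=0 \text{ for all } c\in C\}$. The BCH bounds of $C$ are the integers $\delta$ such that, for some $\alpha\in U_n$, $D_\alpha(C)$ contains a string of $\delta-1$ consecutive integers modulo $n$; $\Delta(C)$ is the maximum of the BCH bounds of $C$. For $f\in\mathbb{L}(n)$ and $\alpha\in U_n$, the inverse Fourier transform of $f$ with respect to $\alpha$ is $\varphi^{-1}_{\alpha,f}(x)=\frac1n\sum_{i=0}^{n-1}f(\alpha^{-i})x^i\in\mathbb{L}(n)$. It is a known fact that $\varphi^{-1}_{\alpha,f}\in\mathbb{F}_q(n)$ for one $\alpha\in U_n$ if and only if this holds for all $\alpha\in U_n$.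
   Formalization: The divisor g is assumed not to be a scalar multiple of x^n-1; for such g the codes are zero, so d(C_α) is undefined and dim C_α = 0 while |supp(g)| = 2. *)

(* Defs.v *)
From mathcomp Require Import all_boot all_order all_fingroup all_algebra.

Set Implicit Arguments.
Unset Strict Implicit.
Unset Printing Implicit Defensive.

Import GRing.Theory.
Local Open Scope ring_scope.

(* The library's {poly %/ h} is the ring of remainders modulo h only for h monic
   of size > 1; hence what follows is meaningful for n > 0 only. *)
Notation cycalg F n := {poly %/ ('X^n - 1 : {poly F})}.

Definition bar (F : fieldType) (n : nat) (f : {poly F}) : cycalg F n :=
  in_qpoly ('X^n - 1) f.

(* For a field embedding e, the induced embedding F(n) -> E(n). *)
Definition map_cycalg (F E : fieldType) (n : nat) (e : F -> E) (c : cycalg F n) :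
    cycalg E n :=
  bar n (map_poly e c).

Definition supp (F : fieldType) (f : {poly F}) : seq nat :=
  [seq i <- iota 0 (size f) | f`_i != 0].

Definition inv_fourier (L : fieldType) (n : nat) (alpha : L) (f : cycalg L n) :
    cycalg L n :=
  bar n (\poly_(i < n) (n%:R^-1 * (f : {poly L}).[alpha ^- i])).

Section Codes.

Variables (F : finFieldType) (n : nat).

(* Codes are F-subspaces of F(n).  The multiples of c already form a subspace,
   see mem_ideal. *)
Definition ideal (c : cycalg F n) : {vspace cycalg F n} :=
  <<[seq u * c | u : cycalg F n]>>%VS.

Lemma mem_ideal (c v : cycalg F n) :
  reflect (exists u, v = u * c) (v \in ideal c).
Proof.
apply: (iffP idP) => [|[u ->]]; last first.
  by apply: memv_span; apply: image_f.
move=> /(@coord_span _ _ _ (in_tuple [seq u * c | u : cycalg F n])) ->.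
apply: (big_ind (fun w => exists u, w = u * c)) => [|x y [u ->] [w ->]|i _].
- by exists 0; rewrite mul0r.
- by exists (u + w); rewrite mulrDl.
- have /imageP[u _ ->] := mem_nth 0 (ltn_ord i).
  by exists (coord (in_tuple [seq u * c | u : cycalg F n]) i v *: u);
    rewrite scalerAl.
Qed.

Definition is_min_distance (C : {vspace cycalg F n}) (d : nat) : Prop :=
  (exists c : cycalg F n, [/\ c \in C, c != 0 & size (supp c) = d]) /\
  (forall c : cycalg F n, c \in C -> c != 0 -> (d <= size (supp c))%N).

(* Moves the coefficient at position i to position s i. *)
Definition permute (s : 'S_n) (v : cycalg F n) : cycalg F n :=
  bar n (\sum_(i < n) v`_i *: 'X^(s i)).

Definition perm_equivalent (C C' : {vspace cycalg F n}) : Prop :=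
  exists s : 'S_n,
    forall w, w \in C' <-> exists2 v, v \in C & w = permute s v.

Variables (L : fieldType) (e : F -> L).

Definition zero_set (alpha : L) (C : {vspace cycalg F n}) : {set 'I_n} :=
  [set i : 'I_n | [forall c : cycalg F n,
     (c \in C) ==> root (map_poly e c) (alpha ^+ i)]].

(* A string of delta - 1 = 0 integers is allowed, so 1 is always a BCH bound
   when L contains a primitive n-th root of unity. *)
Definition is_BCH_bound (C : {vspace cycalg F n}) (delta : nat) : Prop :=
  (0 < delta)%N /\
  exists2 alpha : L, n.-primitive_root alpha &
    exists b : nat, forall (j : nat) (i : 'I_n),
      (j < delta.-1)%N -> i = b + j %[mod n] -> i \in zero_set alpha C.

Definition is_max_BCH_bound (C : {vspace cycalg F n}) (delta : nat) : Prop :=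
  is_BCH_bound C delta /\
  (forall delta', is_BCH_bound C delta' -> (delta' <= delta)%N).

End Codes.

(* Main.v *)
Require Import Defs.
From HB Require Import structures.
From mathcomp Require Import all_boot all_order all_fingroup all_algebra.

Set Implicit Arguments.
Unset Strict Implicit.
Unset Printing Implicit Defensive.

Import GRing.Theory.
Local Open Scope ring_scope.

(** If [f] is the class of [x^k g], then by Fourier inversion the generator
    [c = inv_fourier alpha f] satisfies [c(alpha^i) = f_i].  Hence the number of
    [i] with [c(alpha^i) <> 0], which is the dimension of the ideal [(c)], is
    [|supp f| = |supp g|]; moreover the gap of [n - 1 - deg g] zeros of [f]
    cyclically following its top coefficient makes [n - deg g] a BCH bound.
    On the other hand the coefficients of [c] are, up to a factor, the values of
    [g] at the n-th roots of unity, and [deg g] of these vanish since [g] divides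
    [x^n - 1]: so [c] itself has weight [n - deg g].  As no BCH bound exceeds the
    weight of a nonzero codeword, both the largest BCH bound and the minimum
    distance are [n - deg g].  Changing [alpha] to another primitive root
    applies to [c] an automorphism [x -> x^m] of the cyclic algebra, which
    permutes the coordinates. *)

Definition shift_ord (n : nat) (n_gt0 : (0 < n)%N) (k : nat) (i : 'I_n) : 'I_n :=
  Ordinal (ltn_pmod (k + i) n_gt0).

Lemma shift_ord_inj (n : nat) (n_gt0 : (0 < n)%N) (k : nat) :
  injective (shift_ord n_gt0 k).
Proof.
move=> i j /(congr1 val) /= /eqP.
by rewrite eqn_modDl !modn_small // => /eqP/val_inj.
Qed.

(** * Remainders modulo x^n - 1 and their coefficients *)

Section CyclicAlgebra.

Variables (F : fieldType) (n : nat).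
Hypothesis n_gt0 : (0 < n)%N.

(** The quotient type replaces by a default any modulus that is not monic of size above 1; for
    positive [n] this default is never taken. *)
Lemma mk_monic_Xn_sub_1 : mk_monic ('X^n - 1 : {poly F}) = 'X^n - 1.
Proof. by rewrite /mk_monic size_XnsubC // monicXnsubC // ltnS n_gt0. Qed.

Lemma size_cycalg (c : cycalg F n) : (size c <= n)%N.
Proof.
by apply: leq_trans (size_npoly c) _; rewrite mk_monic_Xn_sub_1 size_XnsubC.
Qed.

Lemma val_bar (p : {poly F}) : bar n p = p %% ('X^n - 1) :> {poly F}.
Proof.
by rewrite /bar /= mk_monic_Xn_sub_1 Pdiv.IdomainMonic.modpE // monicXnsubC.
Qed.

Lemma bar_small (p : {poly F}) : (size p <= n)%N -> bar n p = p :> {poly F}.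
Proof. by move=> szp; rewrite val_bar modp_small // size_XnsubC. Qed.

Lemma bar_cycalg (c : cycalg F n) : bar n c = c.
Proof. by apply: val_inj; exact: bar_small (size_cycalg c). Qed.

Lemma degree_factors (p q : {poly F}) : 'X^n - 1 = q * p ->
  ((size q).-1 + (size p).-1)%N = n.
Proof.
move=> Epq; have := size_XnsubC (1 : F) n_gt0; rewrite Epq => szqp.
have : q * p != 0 by rewrite -size_poly_eq0 szqp.
rewrite mulf_eq0 negb_or => /andP[q0 p0].
move: szqp; rewrite size_mul //; move: q0 p0; rewrite -!size_poly_gt0.
by case: (size q) => // a _; case: (size p) => // b _; rewrite addnS => -[].
Qed.

Lemma barD (p q : {poly F}) : bar n (p + q) = bar n p + bar n q.
Proof. exact: in_qpolyD. Qed.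

Lemma barB (p q : {poly F}) : bar n (p - q) = bar n p - bar n q.
Proof. exact: raddfB. Qed.

Lemma bar1 : bar n (1 : {poly F}) = 1.
Proof. exact: rmorph1. Qed.

Lemma barM (p q : {poly F}) : bar n (p * q) = bar n p * bar n q.
Proof. exact: rmorphM. Qed.

Lemma barX (p : {poly F}) (m : nat) : bar n (p ^+ m) = bar n p ^+ m.
Proof. exact: rmorphXn. Qed.

Lemma barZ (a : F) (p : {poly F}) : bar n (a *: p) = a *: bar n p.
Proof. exact: in_qpolyZ. Qed.

Lemma cycalgM (u v : cycalg F n) :
  u * v = bar n ((u : {poly F}) * (v : {poly F})).
Proof. by rewrite barM !bar_cycalg. Qed.

Lemma bar_Xn : bar n ('X^n : {poly F}) = 1.
Proof.
apply/eqP; rewrite -subr_eq0; apply/eqP.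
rewrite -bar1 -barB; apply: val_inj.
by rewrite [val _]val_bar modpp.
Qed.

Lemma bar_exp_modn (i : nat) :
  bar n ('X^i : {poly F}) = 'X^(i %% n) :> {poly F}.
Proof.
rewrite {1}(divn_eq i n) exprD mulnC exprM barM barX bar_Xn.
rewrite expr1n mul1r bar_small // size_polyXn.
exact: ltn_pmod.
Qed.

Lemma bar_sum_Xn (m : nat) (a : 'I_m -> F) (f : 'I_m -> nat) :
  bar n (\sum_(i < m) a i *: 'X^(f i))
    = \sum_(i < m) a i *: 'X^(f i %% n) :> {poly F}.
Proof.
rewrite -[bar n _]/(in_qpoly _ _) raddf_sum raddf_sum; apply: eq_bigr => i _.
transitivity (polyn (bar n (a i *: 'X^(f i)))) => //.
by rewrite barZ -bar_exp_modn.
Qed.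

Lemma cycalg_eq (u v : cycalg F n) :
  (forall i : 'I_n, (u : {poly F})`_i = (v : {poly F})`_i) -> u = v.
Proof.
move=> uv; apply: val_inj; apply/polyP => i.
have [i_lt | n_le] := ltnP i n; first exact: (uv (Ordinal i_lt)).
by rewrite !nth_default // (leq_trans (size_cycalg _)).
Qed.

Lemma sum_coef_XnE (p : {poly F}) : (size p <= n)%N ->
  p = \sum_(i < n) p`_i *: 'X^i.
Proof.
move=> szp; rewrite -poly_def; apply/polyP => i; rewrite coef_poly.
by case: ltnP => // n_le; rewrite nth_default // (leq_trans szp).
Qed.

Lemma coef_sum_Xn (s : 'I_n -> 'I_n) (a : 'I_n -> F) (j : 'I_n) :
  injective s -> (\sum_(i < n) a i *: 'X^(s i))`_(s j) = a j.
Proof.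
move=> s_inj; rewrite coef_sum (bigD1 j) //= coefZ coefXn eqxx mulr1.
rewrite big1 ?addr0 // => i ij.
by rewrite coefZ coefXn (inj_eq val_inj) (inj_eq s_inj) eq_sym (negPf ij) mulr0.
Qed.

Lemma size_sum_Xn (s : 'I_n -> 'I_n) (a : 'I_n -> F) :
  (size (\sum_(i < n) a i *: 'X^(s i))%R <= n)%N.
Proof.
apply: (leq_trans (size_sum _ _ _)); apply/bigmax_leqP => i _.
by rewrite (leq_trans (size_scale_leq _ _)) // size_polyXn.
Qed.

Lemma coef_bar_shift (k i : nat) (p : {poly F}) : (size p <= n)%N -> (i < n)%N ->
  (bar n ('X^k * p) : {poly F})`_((k + i) %% n) = p`_i.
Proof.
move=> szp i_lt.
have -> : bar n ('X^k * p)
    = \sum_(i < n) p`_i *: 'X^(shift_ord n_gt0 k i) :> {poly F}.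
  rewrite {1}(sum_coef_XnE szp) mulr_sumr.
  under eq_bigr => l _ do rewrite -scalerAr -exprD.
  by rewrite bar_sum_Xn.
exact: coef_sum_Xn (fun i => p`_i) (Ordinal i_lt) (@shift_ord_inj n n_gt0 k).
Qed.

(** Counts the support inside ['I_n], where it can be compared with sets of indices [i] defined by
    values at [alpha ^+ i]. *)
Lemma size_supp (p : {poly F}) : (size p <= n)%N ->
  size (supp p) = #|[set i : 'I_n | p`_i != 0]|.
Proof.
move=> szp; rewrite /supp size_filter cardsE -sum1_card -sum1_count.
have -> : iota 0 (size p) = index_iota 0 (size p) by rewrite /index_iota subn0.
rewrite (big_nat_widen _ _ _ _ _ szp) big_mkord; apply: eq_bigl => i.
rewrite unfold_in; case: ltnP => [|?]; rewrite ?andbT // andbF.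
by rewrite nth_default ?eqxx.
Qed.

End CyclicAlgebra.

(** * Extension of scalars along a field embedding *)

Section Embedding.

Variables (F L : fieldType) (e : {rmorphism F -> L}) (n : nat).
Hypothesis n_gt0 : (0 < n)%N.

Lemma val_map_cycalg (c : cycalg F n) :
  map_cycalg e c = map_poly e c :> {poly L}.
Proof. by rewrite /map_cycalg bar_small // size_map_poly size_cycalg. Qed.

Lemma map_cycalg_inj : injective (map_cycalg (n := n) e).
Proof.
move=> u v /(congr1 (@polyn _ _)); rewrite !val_map_cycalg.
by move/map_poly_inj => uv; apply: val_inj.
Qed.

Lemma map_poly_Xn_sub_1 : map_poly e ('X^n - 1) = 'X^n - 1.
Proof. by rewrite rmorphB rmorph1 /= map_polyXn. Qed.

(** [p] and its remainder differ by a multiple of x^n - 1, so evaluation at n-th roots of unity is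
    well defined on classes. *)
Lemma horner_map_bar (p : {poly F}) (z : L) : z ^+ n = 1 ->
  (map_poly e (bar n p)).[z] = (map_poly e p).[z].
Proof.
move=> zn1; rewrite val_bar // [in RHS](divp_eq p ('X^n - 1)) rmorphD rmorphM.
by rewrite /= map_poly_Xn_sub_1 !hornerE zn1 subrr mulr0 add0r.
Qed.

Lemma map_cycalg_bar (p : {poly F}) :
  map_cycalg e (bar n p) = bar n (map_poly e p).
Proof.
apply: val_inj; rewrite [LHS]val_map_cycalg [RHS]val_bar // val_bar //.
by rewrite map_modp map_poly_Xn_sub_1.
Qed.

Lemma horner_map_cycalgM (u v : cycalg F n) (z : L) : z ^+ n = 1 ->
  (map_poly e (u * v)).[z] = (map_poly e u).[z] * (map_poly e v).[z].
Proof.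
by move=> zn1; rewrite cycalgM // horner_map_bar // rmorphM hornerM.
Qed.

Lemma supp_map_poly (p : {poly F}) : supp (map_poly e p) = supp p.
Proof.
rewrite /supp size_map_poly; apply: eq_in_filter => i _.
by rewrite coef_map fmorph_eq0.
Qed.

End Embedding.

Lemma prim_rootV (F : fieldType) (n : nat) (z : F) :
  n.-primitive_root z -> n.-primitive_root z^-1.
Proof.
case/andP=> n_gt0 /forallP z_prim; apply/andP; split=> //; apply/forallP => i.
by have := z_prim i; rewrite !unity_rootE exprVn invr_eq1.
Qed.

(** * Root counting, the BCH inequality and Fourier inversion *)

Section PrimitiveRoot.

Variables (L : fieldType) (n : nat) (alpha : L).
Hypothesis alpha_prim : n.-primitive_root alpha.

Let n_gt0 : (0 < n)%N := prim_order_gt0 alpha_prim.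

Lemma prim_expX_order (i : nat) : (alpha ^+ i) ^+ n = 1.
Proof. by rewrite exprAC (prim_expr_order alpha_prim) expr1n. Qed.

Lemma prim_exp_inj : injective (fun i : 'I_n => alpha ^+ i).
Proof.
move=> i j /eqP; rewrite (eq_prim_root_expr alpha_prim) !modn_small //.
by move/eqP/val_inj.
Qed.

Lemma card_roots_le (p : {poly L}) : p != 0 ->
  (#|[set i : 'I_n | root p (alpha ^+ i)]| <= (size p).-1)%N.
Proof.
move=> p0; set A := [set i | _].
rewrite -ltnS prednK ?size_poly_gt0 // cardE.
rewrite -(size_map (fun i : 'I_n => alpha ^+ i) (enum A)).
apply: max_poly_roots => //.
  by apply/allP => _ /mapP[i + ->]; rewrite mem_enum inE.
by rewrite map_inj_uniq ?enum_uniq //; exact: prim_exp_inj.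
Qed.

(** With x^n - 1 = q p, the roots of [q] and [p] together cover all n powers of [alpha]. Each factor
    has at most as many roots as its degree and the degrees add up to n, so equality holds. *)
Lemma card_roots_dvd (p : {poly L}) : p %| 'X^n - 1 ->
  #|[set i : 'I_n | root p (alpha ^+ i)]| = (size p).-1.
Proof.
move=> /dvdpP[q Epq].
have : q * p != 0 by rewrite -Epq -size_poly_eq0 size_XnsubC.
rewrite mulf_eq0 negb_or => /andP[q0 p0].
apply/eqP; rewrite eqn_leq card_roots_le //=.
have szpq := degree_factors n_gt0 Epq.
rewrite -(leq_add2l (size q).-1) szpq.
apply: leq_trans (leq_add (card_roots_le q0) (leqnn _)).
apply: leq_trans (leq_card_setU _ _); rewrite -[leqLHS]card_ord -cardsT.
apply/subset_leq_card/subsetP => i _; rewrite !inE -rootM -Epq.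
by rewrite rootE !hornerE prim_expX_order subrr.
Qed.

(* A combination of the power sums [\sum_i p_i alpha^(i (b + l))] isolates any
   single nonzero term of [p], using the polynomial [q] of degree [|supp p| - 1]
   that vanishes at all the other locators. *)
Lemma BCH_bound (p : {poly L}) (b delta : nat) :
  (size p <= n)%N -> p != 0 ->
  (forall j, (j < delta.-1)%N -> root p (alpha ^+ (b + j))) ->
  (delta <= size (supp p))%N.
Proof.
move=> szp p0 p_root; rewrite leqNgt; apply/negP.
rewrite (size_supp szp) => ltS; set S := [set i | _] in ltS.
have [i0 i0S] : exists i0, i0 \in S.
  apply/set0Pn; apply: contraNneq p0 => S0; apply/eqP/polyP => i; rewrite coef0.
  have [i_lt|?] := ltnP i n; last by rewrite nth_default // (leq_trans szp).
  by have /setP/(_ (Ordinal i_lt)) := S0; rewrite !inE => /negbFE/eqP.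
pose q := \prod_(i in S :\ i0) ('X - (alpha ^+ i)%:P).
have szq : size q = #|S|.
  by rewrite /q -big_enum size_prod_XsubC -cardE [in RHS](cardsD1 i0) i0S.
pose T := \sum_(i < n) p`_i * alpha ^+ (i * b) * q.[alpha ^+ i].
have : T = 0.
  transitivity (\sum_(l < size q) q`_l * p.[alpha ^+ (b + l)]).
    under [RHS]eq_bigr => l _ do
      rewrite (horner_coef_wide _ szp) mulr_sumr.
    rewrite exchange_big; apply: eq_bigr => i _; rewrite horner_coef mulr_sumr.
    apply: eq_bigr => l _; rewrite mulrCA -!mulrA; congr (_ * (_ * _)).
    by rewrite -!exprM -exprD -mulnDr mulnC.
  (* [size q] is |S| < [delta], so [l] stays below [delta.-1] and each value of [p] involved
     vanishes. *)
  rewrite big1 // => l _; apply/eqP; rewrite mulf_eq0 orbC.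
  rewrite [_ == 0]p_root //.
  by apply: leq_trans (ltn_ord l) _; rewrite szq; case: (delta) ltS.
rewrite /T (bigD1 i0) //= big1 => [|i ii0]; last first.
  have [iS|] := boolP (i \in S); last first.
    by rewrite inE negbK => /eqP->; rewrite !mul0r.
  apply/eqP; rewrite mulf_eq0 orbC horner_prod (bigD1 i) /= ?inE ?ii0 //.
    by rewrite hornerXsubC subrr mul0r eqxx.
  by move: iS; rewrite inE.
rewrite addr0 => /eqP; apply/negP; rewrite !mulf_neq0 //.
- by move: i0S; rewrite inE.
- by rewrite expf_neq0 // (prim_root_eq0 alpha_prim) -lt0n.
- rewrite horner_prod; apply/prodf_neq0 => i; rewrite !inE => /andP[ii0 _].
  rewrite hornerXsubC subr_eq0; apply: contra ii0 => /eqP/prim_exp_inj->.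
  by rewrite eqxx.
Qed.

Lemma coef_inv_fourier (f : cycalg L n) (i : nat) : (i < n)%N ->
  (inv_fourier alpha f : {poly L})`_i = n%:R^-1 * (f : {poly L}).[alpha ^- i].
Proof.
by move=> i_lt; rewrite /inv_fourier bar_small ?size_poly // coef_poly i_lt.
Qed.

(** Orthogonality of characters: after exchanging the sums, f_l is multiplied by the sum over i of
    (alpha^j / alpha^l)^i, which is n for l = j and 0 otherwise. *)
Lemma horner_inv_fourier (f : cycalg L n) (j : nat) : (j < n)%N ->
  (inv_fourier alpha f : {poly L}).[alpha ^+ j] = (f : {poly L})`_j.
Proof.
move=> j_lt; rewrite (horner_coef_wide _ (size_cycalg n_gt0 _)).
under eq_bigr => i _ do rewrite coef_inv_fourier //
  (horner_coef_wide _ (size_cycalg n_gt0 _)) -mulrA mulr_suml.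
rewrite -mulr_sumr exchange_big /= (bigD1 (Ordinal j_lt)) //=.
have alpha0 : alpha != 0 by rewrite (prim_root_eq0 alpha_prim) -lt0n.
rewrite [X in _ + X]big1 => [|l lj].
  rewrite addr0 (eq_bigr (fun=> (f : {poly L})`_j)) => [|i _].
    (* [n] is invertible in [L] because [L] contains a primitive n-th root of unity. *)
    rewrite sumr_const card_ord -[_`_j *+ n]mulr_natl mulKf //.
    exact: prim_root_natf_neq0 alpha_prim.
  by rewrite -mulrA exprVn -!exprM mulnC mulVf ?mulr1 // expf_neq0.
(* An n-th root of unity other than 1: w^n - 1 = (w - 1) (1 + w + ... + w^(n-1)) forces the
   geometric sum to vanish. *)
pose w := alpha ^+ j / alpha ^+ l.
have wn1 : w ^+ n = 1 by rewrite expr_div_n !prim_expX_order divr1.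
have w1 : w - 1 != 0.
  rewrite subr_eq0 -(inj_eq (mulIf (expf_neq0 l alpha0))) mulfVK ?expf_neq0 //.
  rewrite mul1r (eq_prim_root_expr alpha_prim) !modn_small //.
  by apply: contra lj => /eqP jl; apply/eqP/val_inj.
rewrite (eq_bigr (fun i : 'I_n => (f : {poly L})`_l * w ^+ i)) => [|i _].
  apply/eqP; rewrite -mulr_sumr mulf_eq0; apply/orP; right.
  by rewrite -(inj_eq (mulfI w1)) -subrX1 wn1 subrr mulr0.
rewrite -mulrA; congr (_ * _).
by rewrite expr_div_n exprVn [_ ^+ i ^+ l]exprAC mulrC.
Qed.

End PrimitiveRoot.

(** * Coordinate permutations acting on principal ideals *)

Section Ideals.

Variables (F : finFieldType) (n : nat).
Hypothesis n_gt0 : (0 < n)%N.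

Lemma coef_permute (s : 'S_n) (v : cycalg F n) (i : 'I_n) :
  (permute s v : {poly F})`_(s i) = (v : {poly F})`_i.
Proof.
rewrite /permute bar_small ?size_sum_Xn //.
exact: (coef_sum_Xn (fun i => (v : {poly F})`_i)) (@perm_inj _ s).
Qed.

Lemma permuteKV (s : 'S_n) : cancel (permute (F := F) s^-1) (permute s).
Proof.
move=> v; apply: cycalg_eq => // i.
by rewrite -[i in LHS](permKV s) coef_permute coef_permute.
Qed.

(** A multiplicative permutation sends multiples of [c] to multiples of its image; all of them are
    reached, since each factor [u] is the image of [permute s^-1 u]. *)
Lemma perm_equivalent_ideal (s : 'S_n) (c : cycalg F n) :
  {morph permute s : u v / u * v : cycalg F n} ->
  perm_equivalent (ideal c) (ideal (permute s c)).
Proof.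
move=> sM; exists s => w; split=> [/mem_ideal[u ->] | [_ /mem_ideal[u ->] ->]].
  exists (permute s^-1 u * c); first by apply/mem_ideal; exists (permute s^-1 u).
  by rewrite sM permuteKV.
by rewrite sM; apply/mem_ideal; exists (permute s u).
Qed.

(** * The automorphism x -> x^m of the cyclic algebra *)

Section Multiplier.

Variable m : nat.
Hypothesis co_m_n : coprime m n.

Definition multiplier_fun (i : 'I_n) : 'I_n := Ordinal (ltn_pmod (m * i) n_gt0).

(** [n] divides m (j - i) and is prime to [m], hence divides j - i; the reduction to [i <= j] keeps
    the subtraction of naturals exact. *)
Lemma multiplier_fun_inj : injective multiplier_fun.
Proof.
move=> i j; wlog le_ij : i j / (i <= j)%N => [W eq_ij|].
  by case: (leqP i j) => [/W->|/ltnW/W->].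
move=> /(congr1 val)/esym/eqP /=; rewrite eqn_mod_dvd ?leq_mul //.
rewrite -mulnBr Gauss_dvdr 1?coprime_sym // -eqn_mod_dvd // !modn_small //.
by move/eqP/val_inj.
Qed.

Definition multiplier : 'S_n := perm multiplier_fun_inj.

(** Recasts the permutation as a substitution, from which multiplicativity can be read off. *)
Lemma permute_multiplier (v : cycalg F n) :
  permute multiplier v = bar n ((v : {poly F}) \Po 'X^m).
Proof.
have -> : (v : {poly F}) \Po 'X^m
    = \sum_(i < n) (v : {poly F})`_i *: 'X^(m * i).
  rewrite [X in X \Po _](sum_coef_XnE (size_cycalg n_gt0 v)) linear_sum /=.
  by apply: eq_bigr => i _; rewrite linearZ /= rmorphXn /= comp_polyX -exprM.
apply: val_inj; rewrite [RHS](bar_sum_Xn n_gt0) [LHS]bar_small ?size_sum_Xn //.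
by apply: eq_bigr => i _; rewrite permE.
Qed.

(** The substitution turns x^n - 1 into x^(nm) - 1, whose class is zero, so it descends to the
    quotient. *)
Lemma bar_comp_Xn (p : {poly F}) :
  bar n ((bar n p : {poly F}) \Po 'X^m) = bar n (p \Po 'X^m).
Proof.
rewrite val_bar // [p in RHS](divp_eq p ('X^n - 1)) comp_polyD comp_polyM.
have ->: ('X^n - 1 : {poly F}) \Po 'X^m = ('X^n) ^+ m - 1.
  by rewrite rmorphB rmorph1 /= rmorphXn /= comp_polyX exprAC.
by rewrite barD barM barB barX bar_Xn // expr1n bar1 subrr mulr0 add0r.
Qed.

Lemma permute_multiplierM :
  {morph permute multiplier : u v / u * v : cycalg F n}.
Proof.
move=> u v; rewrite !permute_multiplier -barM -comp_polyM.
by rewrite [in LHS]cycalgM // bar_comp_Xn.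
Qed.

End Multiplier.

End Ideals.

(** * Dimension of a principal ideal *)

Section MulGenerator.

Variables (F : fieldType) (n m : nat) (h : {poly F}).

(** The source is restricted to polynomials of size at most [m], a space of dimension [m], so that
    the dimension of the image can be computed from the kernel. *)
Definition mul_bar (p : {poly_m F}) : cycalg F n := bar n ((p : {poly F}) * h).

Lemma mul_bar_is_linear : linear mul_bar.
Proof. by move=> a p q; rewrite /mul_bar /= mulrDl -scalerAl barD barZ. Qed.

HB.instance Definition _ :=
  GRing.isLinear.Build F {poly_m F} (cycalg F n) *:%R mul_bar mul_bar_is_linear.

End MulGenerator.

Section Dimension.

Variables (F : finFieldType) (L : fieldType) (e : {rmorphism F -> L}) (n : nat).
Variable alpha : L.
Hypothesis alpha_prim : n.-primitive_root alpha.

Let n_gt0 : (0 < n)%N := prim_order_gt0 alpha_prim.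

(* With [h] a gcd of [c] and [x^n - 1], the ideal [(c)] is the injective image of
   the polynomials of size at most [n - deg h] under multiplication by [h]. *)
Lemma dim_ideal (c : cycalg F n) :
  \dim (ideal c) = #|[set i : 'I_n | ~~ root (map_poly e c) (alpha ^+ i)]|.
Proof.
(* [h] is the associate of the gcd given by u c + v (x^n - 1), hence a multiple of [c] modulo x^n -
   1. *)
have [[u v] /= Eh] := Bezoutp (c : {poly F}) ('X^n - 1).
set h := _ + _ in Eh.
have Xn0 : ('X^n - 1 : {poly F}) != 0 by rewrite -size_poly_eq0 size_XnsubC.
have [k Ek] : exists k, 'X^n - 1 = k * h.
  by apply/dvdpP; rewrite (eqp_dvdl _ Eh) dvdp_gcdr.
have [d Ed] : exists d, c = d * h :> {poly F}.
  by apply/dvdpP; rewrite (eqp_dvdl _ Eh) dvdp_gcdl.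
have /andP[k0 h0] : (k != 0) && (h != 0) by rewrite -negb_or -mulf_eq0 -Ek.
have szkh := degree_factors n_gt0 Ek.
have roots_h : [set i : 'I_n | root (map_poly e c) (alpha ^+ i)]
    = [set i : 'I_n | root (map_poly e h) (alpha ^+ i)].
  apply/setP => i; rewrite !inE.
  have /eqp_root -> : map_poly e h %= map_poly e (gcdp c ('X^n - 1)).
    by rewrite eqp_map.
  rewrite gcdp_map root_gcd map_poly_Xn_sub_1 [X in _ && X]rootE !hornerE.
  by rewrite (prim_expX_order alpha_prim) subrr eqxx andbT.
(* As a divisor of x^n - 1, [h] has exactly deg h roots among the powers of [alpha], which leaves n
   - deg h = deg k nonroots. *)
have -> : #|[set i : 'I_n | ~~ root (map_poly e c) (alpha ^+ i)]| = (size k).-1.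
  have /card_roots_dvd : map_poly e h %| 'X^n - 1.
    by rewrite -(map_poly_Xn_sub_1 e) dvdp_map Ek dvdp_mull.
  move=> /(_ _ alpha_prim); rewrite -roots_h size_map_poly => Eroots.
  have := cardsC [set i : 'I_n | root (map_poly e c) (alpha ^+ i)].
  rewrite card_ord Eroots addnC => EC.
  apply: (@addIn (size h).-1); rewrite szkh -[RHS]EC; congr (_ + _)%N.
  by apply: eq_card => i; rewrite !inE.
set m := (size k).-1.
pose f := linfun (mul_bar n h : {poly_m F} -> cycalg F n).
have <- : limg f = ideal c.
  apply/eqP; rewrite eqEsubv; apply/andP; split; apply/subvP => w.
    move=> /memv_imgP[p _ ->]; rewrite lfunE /=; apply/mem_ideal.
    exists (bar n ((p : {poly F}) * u)).
    rewrite -[c in RHS](bar_cycalg n_gt0) -barM /mul_bar /h mulrDr barD.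
    rewrite !mulrA [bar n (_ * ('X^n - 1))]barM barB bar_Xn // bar1 subrr.
    by rewrite mulr0 addr0.
  move=> /mem_ideal[q ->]; apply/memv_imgP.
  (* Reducing the cofactor modulo [k] brings its size down to [m] and changes its product with [h]
     by a multiple of k h = x^n - 1 only. *)
  pose p := ((q : {poly F}) * d) %% k.
  have szp : (size p <= m)%N by rewrite -ltnS prednK ?size_poly_gt0 ?ltn_modp.
  exists (npolyp m p); rewrite ?memvf // lfunE /= /mul_bar npolypK //.
  rewrite cycalgM // Ed mulrA [_ * d](divp_eq _ k) mulrDl -mulrA -Ek barD barM barB.
  by rewrite bar_Xn // bar1 subrr mulr0 add0r.
suff /eqP kerf : lker f == 0%VS.
  by rewrite limg_dim_eq ?kerf ?capv0 // dim_polyn.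
rewrite -subv0; apply/subvP => p; rewrite memv_ker memv0 lfunE /= => /eqP fp0.
(* The product has size at most [n], so it is its own remainder and vanishes with its class. *)
have /eqP : (p : {poly F}) * h = 0.
  transitivity (mul_bar n h p : {poly F}); last by rewrite fp0.
  rewrite /mul_bar bar_small // (leq_trans (size_polyMleq _ _)) // -szkh.
  rewrite -subn1 leq_subLR addnCA add1n prednK ?size_poly_gt0 //.
  by rewrite leq_add2r size_npoly.
by rewrite mulf_eq0 (negPf h0) orbF -val_eqE.
Qed.

End Dimension.

(** A divisor of size above [n] would be an associate of x^n - 1, whose class is zero. *)
Lemma size_dvd_Xn_sub_1 (F : fieldType) (n : nat) (g : {poly F}) :
  (0 < n)%N -> g %| 'X^n - 1 -> bar n g != 0 -> (size g <= n)%N.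
Proof.
move=> n_gt0 g_dvd; apply: contraNleq => lt_n_g.
have Xn0 : ('X^n - 1 : {poly F}) != 0 by rewrite -size_poly_eq0 size_XnsubC.
have /eqp_dvdr Eg : g %= 'X^n - 1.
  rewrite -dvdp_size_eqp // eqn_leq dvdp_leq //=.
  by rewrite size_XnsubC.
rewrite -val_eqE [val (bar n g)]val_bar //.
by apply/eqP/modp_eq0P; rewrite Eg.
Qed.

(** * BCH bounds compared with weights of codewords *)

Section Bounds.

Variables (F : finFieldType) (L : fieldType) (e : {rmorphism F -> L}) (n : nat).
Hypothesis n_gt0 : (0 < n)%N.

Lemma mem_ideal_gen (c : cycalg F n) : c \in ideal c.
Proof. by apply/mem_ideal; exists 1; rewrite mul1r. Qed.

(** Evaluation at an n-th root of unity is multiplicative on classes, so a root of the generator is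
    a root of all its multiples. *)
Lemma mem_zero_set_ideal (alpha : L) (c : cycalg F n) (i : 'I_n) :
  n.-primitive_root alpha ->
  (i \in zero_set e alpha (ideal c)) = root (map_poly e c) (alpha ^+ i).
Proof.
move=> alpha_prim; rewrite inE; apply/forallP/idP => [/(_ c)|c_root v].
  by rewrite mem_ideal_gen.
apply/implyP => /mem_ideal[u ->].
rewrite rootE horner_map_cycalgM ?prim_expX_order //.
by rewrite (eqP c_root) mulr0.
Qed.

Lemma le_BCH_bound_weight (C : {vspace cycalg F n}) (c : cycalg F n) delta :
  is_BCH_bound e C delta -> c \in C -> c != 0 -> (delta <= size (supp c))%N.
Proof.
move=> [_ [alpha alpha_prim [b zeros]]] cC c0; rewrite -(supp_map_poly e).
apply: (BCH_bound (b := b) alpha_prim).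
- by rewrite size_map_poly size_cycalg.
- by rewrite map_poly_eq0 -val_eqE in c0 *.
- move=> j j_lt; rewrite -(prim_expr_mod alpha_prim).
  have := zeros j (Ordinal (ltn_pmod (b + j) n_gt0)) j_lt (modn_mod _ _).
  by rewrite inE => /forallP/(_ c)/implyP/(_ cC).
Qed.

(** The weight of [c] dominates every BCH bound; being itself a BCH bound, it is also at most the
    weight of every nonzero codeword. *)
Lemma max_BCH_bound_min_distance (C : {vspace cycalg F n}) (c : cycalg F n) :
  c \in C -> c != 0 -> is_BCH_bound e C (size (supp c)) ->
  is_max_BCH_bound e C (size (supp c)) /\ is_min_distance C (size (supp c)).
Proof.
move=> cC c0 bch; split; split=> //.
- by move=> delta /le_BCH_bound_weight; apply.
- by exists c.
- by move=> v; apply: le_BCH_bound_weight.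
Qed.

(** Since gamma^(-m i) = alpha^(-i), the coefficient at m i of the transform for [gamma] is the
    coefficient at i of the one for [alpha]. *)
Lemma inv_fourier_multiplier (alpha gamma : L) (m : nat) (co_m_n : coprime m n)
    (f : cycalg L n) (c : cycalg F n) :
  n.-primitive_root alpha -> n.-primitive_root gamma -> gamma ^+ m = alpha ->
  map_cycalg e c = inv_fourier alpha f ->
  map_cycalg e (permute (multiplier n_gt0 co_m_n) c) = inv_fourier gamma f.
Proof.
move=> alpha_prim gamma_prim gammaE Ec; apply: cycalg_eq => // i.
rewrite -(permKV (multiplier n_gt0 co_m_n) i); set j := (_ i).
rewrite val_map_cycalg // coef_map coef_permute // -coef_map.
rewrite -val_map_cycalg // Ec !coef_inv_fourier // permE /=.
by rewrite (prim_expr_mod gamma_prim) exprM gammaE.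
Qed.

(** * Weight, zeros and dimension of a code generated by an inverse transform *)

Section FourierCode.

Variables (alpha : L) (G : {poly L}) (k : nat) (c : cycalg F n).
Hypotheses (alpha_prim : n.-primitive_root alpha) (G_dvd : G %| 'X^n - 1).
Hypothesis szG : (size G <= n)%N.
Hypothesis Ec : map_cycalg e c = inv_fourier alpha (bar n ('X^k * G)).

Lemma root_fourier_code (i : nat) : (i < n)%N ->
  root (map_poly e c) (alpha ^+ ((k + i) %% n)) = (G`_i == 0).
Proof.
move=> i_lt; rewrite rootE -val_map_cycalg // Ec horner_inv_fourier ?ltn_pmod //.
by rewrite coef_bar_shift.
Qed.

Lemma weight_fourier_code : size (supp c) = (n - (size G).-1)%N.
Proof.
have alphaV_prim := prim_rootV alpha_prim.
rewrite (size_supp (size_cycalg n_gt0 c)) -(card_roots_dvd alphaV_prim G_dvd).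
set A := [set i | root _ _].
have := cardsC A; rewrite card_ord => EA.
apply: (@addIn #|A|); rewrite subnK ?max_card; last first.
  by rewrite -[leqRHS]EA leq_addr.
rewrite -[RHS]EA addnC; congr (_ + _)%N; apply: eq_card => i; rewrite !inE.
rewrite -(fmorph_eq0 e) -coef_map -val_map_cycalg // Ec coef_inv_fourier //.
have zn1 : (alpha^-1 ^+ i) ^+ n = 1 by rewrite prim_expX_order.
rewrite -exprVn mulf_eq0 invr_eq0 (negPf (prim_root_natf_neq0 alpha_prim)) /=.
(* The identity embedding lets the class of ['X^k * G] be evaluated through this product, whose
   factor alpha^(-i k) never vanishes. *)
have := horner_map_bar idfun n_gt0 ('X^k * G) zn1; rewrite !map_poly_id // => ->.
rewrite hornerM hornerXn mulf_eq0 expf_eq0 [_ ^+ i == 0]expf_eq0.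
by rewrite (prim_root_eq0 alphaV_prim) -[n == _]negbK -lt0n n_gt0 !andbF.
Qed.

Let G_size_gt0 : (0 < size G)%N.
Proof.
rewrite size_poly_gt0; apply: contraTneq G_dvd => ->.
by rewrite dvd0p -size_poly_eq0 size_XnsubC.
Qed.

Lemma fourier_code_neq0 : c != 0.
Proof.
have := weight_fourier_code; apply: contra_eqN => /eqP->.
by rewrite /supp size_poly0 eq_sym -lt0n subn_gt0 -ltnS prednK.
Qed.

Lemma BCH_fourier_code : is_BCH_bound e (ideal c) (size (supp c)).
Proof.
rewrite weight_fourier_code; split; first by rewrite subn_gt0 -ltnS prednK.
(* The string starts just past the shifted top coefficient: the indices from [size G] to n - 1 give
   n - [size G] zeros, one less than n - deg G. *)
exists alpha => //; exists (k + size G)%N => j i j_lt Ei.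
have lt_n : (size G + j < n)%N.
  by move: j_lt; rewrite -subnS prednK // ltn_subRL.
rewrite mem_zero_set_ideal // -[X in alpha ^+ X](modn_small (ltn_ord i)) Ei.
by rewrite -addnA root_fourier_code // nth_default // leq_addr.
Qed.

Lemma dim_fourier_code : \dim (ideal c) = size (supp G).
Proof.
rewrite (dim_ideal e alpha_prim) (size_supp szG).
rewrite -(card_preimset _ (@shift_ord_inj n n_gt0 k)); apply: eq_card => i.
by rewrite !inE root_fourier_code.
Qed.

End FourierCode.

End Bounds.

Theorem corollary18
  (F : finFieldType) (K L : fieldType)
  (jK : {rmorphism F -> K}) (jL : {rmorphism K -> L})
  (n : nat) (n_gt0 : (0 < n)%N) (co_n_q : coprime n #|F|)
  (g : {poly K}) (g_dvd : g %| 'X^n - 1) (g_neq0 : bar n g != 0)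
  (beta : L) (beta_prim : n.-primitive_root beta)
  (k : nat) (k_lt_n : (k < n)%N)
  (hbeta : exists c : cycalg F n,
     map_cycalg (jL \o jK) c = inv_fourier beta (map_cycalg jL (bar n ('X^k * g)))) :
  exists c : L -> cycalg F n,
    [/\ forall alpha, n.-primitive_root alpha ->
          map_cycalg (jL \o jK) (c alpha)
            = inv_fourier alpha (map_cycalg jL (bar n ('X^k * g))),
        forall alpha alpha',
          n.-primitive_root alpha -> n.-primitive_root alpha' ->
          perm_equivalent (ideal (c alpha)) (ideal (c alpha')),
        forall alpha, n.-primitive_root alpha ->
          exists2 d : nat, is_max_BCH_bound (jL \o jK) (ideal (c alpha)) d
                         & is_min_distance (ideal (c alpha)) d
      & forall alpha, n.-primitive_root alpha ->
          \dim (ideal (c alpha)) = size (supp g)].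
Proof.
pose e : {rmorphism F -> L} := jL \o jK.
pose G := map_poly jL g.
have szg := size_dvd_Xn_sub_1 n_gt0 g_dvd g_neq0.
have szG : (size G <= n)%N by rewrite size_map_poly.
have G_dvd : G %| 'X^n - 1 by rewrite -(map_poly_Xn_sub_1 jL) dvdp_map.
have Ef : map_cycalg jL (bar n ('X^k * g)) = bar n ('X^k * G).
  by rewrite map_cycalg_bar // rmorphM /= map_polyXn.
rewrite Ef in hbeta *; case: hbeta => c0 Ec0.
(* The default 0 is taken only where the transform has no preimage over [F]. *)
pose c alpha := odflt 0
  [pick v | map_cycalg e v == inv_fourier alpha (bar n ('X^k * G))].
have Ec alpha : n.-primitive_root alpha ->
    map_cycalg e (c alpha) = inv_fourier alpha (bar n ('X^k * G)).
  move=> alpha_prim; rewrite /c; case: pickP => [v /eqP //|no_v].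
  (* [beta] is a power alpha^m, with [m] prime to [n] because [beta] is primitive too; the
     multiplier of [m] carries [c0] to a preimage for [alpha]. *)
  have [m Em] := prim_rootP alpha_prim (prim_expr_order beta_prim).
  have co_m_n : coprime m n.
    by rewrite -(prim_root_exp_coprime _ alpha_prim) -Em.
  have := no_v (permute (multiplier n_gt0 co_m_n) c0).
  by rewrite (inv_fourier_multiplier _ _ beta_prim alpha_prim (esym Em) Ec0) eqxx.
exists c; split=> //.
- move=> alpha gamma alpha_prim gamma_prim.
  have [m Em] := prim_rootP gamma_prim (prim_expr_order alpha_prim).
  have co_m_n : coprime m n.
    by rewrite -(prim_root_exp_coprime _ gamma_prim) -Em.
  (* Both sides have the same image over [L], and extension of scalars is injective. *)
  have -> : c gamma = permute (multiplier n_gt0 co_m_n) (c alpha).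
    apply: (map_cycalg_inj (e := e) n_gt0); rewrite Ec //.
    by rewrite (inv_fourier_multiplier _ _ alpha_prim gamma_prim (esym Em) (Ec _ _)).
  exact: perm_equivalent_ideal (permute_multiplierM _ _).
- move=> alpha alpha_prim; have Ecalpha := Ec _ alpha_prim.
  have [max_bch min_dist] := max_BCH_bound_min_distance n_gt0 (mem_ideal_gen _)
    (fourier_code_neq0 n_gt0 alpha_prim G_dvd szG Ecalpha)
    (BCH_fourier_code n_gt0 alpha_prim G_dvd szG Ecalpha).
  by exists (size (supp (c alpha))).
- move=> alpha alpha_prim; rewrite (dim_fourier_code n_gt0 alpha_prim szG (Ec _ alpha_prim)).
  by rewrite supp_map_poly.
Qed.
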